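(* Let $d\in\mathbb{N}$. Then the ring $A_{\mathrm{sym}}(\mathbb{D}^d)$ is not coherent.
   Context: $\mathbb{N}=\{1,2,3,\dots\}$, $\mathbb{D}=\{z\in\mathbb{C}:|z|<1\}$, and $\overline{\mathbb{D}}$ is its closure in $\mathbb{C}$. For $d\in\mathbb{N}$, $A(\mathbb{D}^d)$ is the polydisc algebra of all functions $f:\overline{\mathbb{D}}^d\to\mathbb{C}$ that are holomorphic in $\mathbb{D}^d$ and continuous on $\overline{\mathbb{D}}^d$, with pointwise operations. The symmetric group $S_d$ of all permutations of $\{1,\dots,d\}$ acts by $\sigma\mathbf{z}=(z_{\sigma(1)},\dots,z_{\sigma(d)})$ for $\mathbf{z}=(z_1,\dots,z_d)\in\mathbb{C}^d$. A function $f\in A(\mathbb{D}^d)$ is symmetric if $f(\sigma\mathbf{z})=f(\mathbf{z})$ for all $\mathbf{z}\in\mathbb{D}^d$ and all $\sigma\in S_d$. $A_{\mathrm{sym}}(\mathbb{D}^d)$ is the subalgebra of $A(\mathbb{D}^d)$ consisting of all symmetric functions in $A(\mathbb{D}^d)$. A unital commutative ring $R$ is coherent if the intersection of any two finitely generated ideals in $R$ is finitely generated, and for every $a\in R$ the annihilator $\mathrm{Ann}(a)=\{x\in R: ax=0\}$ is finitely generated. *)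

(* Defs.v *)
From HB Require Import structures.
From mathcomp Require Import all_boot all_order all_algebra all_fingroup.
From mathcomp Require Import all_classical all_reals all_analysis.
From mathcomp Require Import complex.

Set Implicit Arguments.
Unset Strict Implicit.
Unset Printing Implicit Defensive.

Import Order.TTheory GRing.Theory Num.Theory.
Import numFieldNormedType.Exports.

Local Open Scope classical_set_scope.
Local Open Scope ring_scope.

Section Coherent.
Variable A : comPzRingType.

Definition ideal_gen (s : seq A) : set A :=
  [set x | exists c : 'I_(size s) -> A, x = \sum_(i < size s) c i * s`_i].

Definition fg_ideal (I : set A) : Prop := exists s : seq A, I = ideal_gen s.

Definition annihilator (a : A) : set A := [set x | a * x = 0].

Definition coherent : Prop :=
  (forall I J : set A, fg_ideal I -> fg_ideal J -> fg_ideal (I `&` J)) /\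
  (forall a : A, fg_ideal (annihilator a)).

End Coherent.

(* R[i] as a normed space over itself, as MathComp-Analysis does for an
   abstract numClosedFieldType *)
HB.instance Definition _ (R : rcfType) := GRing.ComAlgebra.copy R[i] R[i]^o.
HB.instance Definition _ (R : rcfType) := Vector.copy R[i] R[i]^o.
HB.instance Definition _ (R : rcfType) := NormedModule.copy R[i] R[i]^o.
HB.instance Definition _ (R : rcfType) := Num.ClosedField.on R[i].

Section PolydiscAlgebra.
Variables (R : realType) (d : nat).
Local Notation C := R[i].

Definition disc : set C := [set z | `|z| < 1].

Definition polydisc : set 'rV[C]_d := [set z | forall j, disc (z ord0 j)].

Definition cpolydisc : set 'rV[C]_d :=
  [set z | forall j, closure disc (z ord0 j)].

(* The value of f : cpolydisc -> C at a point z : 'rV[C]_d; the junk value 0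
   outside of the closed polydisc is never used below, since the open polydisc
   is open and contained in cpolydisc. *)
Definition evalc (f : cpolydisc -> C) : 'rV[C]_d -> C := 'valL_0 f.

(* differentiable is Frechet differentiability over the field C, i.e.,
   with a C-linear differential. *)
Definition holomorphic_on (U : set 'rV[C]_d) (F : 'rV[C]_d -> C) : Prop :=
  forall z : 'rV[C]_d, U z -> differentiable F z.

Definition polydisc_algebra : set (cpolydisc -> C) :=
  [set f | holomorphic_on polydisc (evalc f) /\ continuous f].

(* col_perm s z is the row vector (z_{s 0}, ..., z_{s (d - 1)}). *)
Definition symmetric_on_polydisc (f : cpolydisc -> C) : Prop :=
  forall (s : 'S_d) (z : 'rV[C]_d), polydisc z ->
    evalc f (col_perm s z) = evalc f z.

Definition sym_polydisc_algebra : set (cpolydisc -> C) :=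
  [set f | polydisc_algebra f /\ symmetric_on_polydisc f].

Definition Asym_pred : {pred cpolydisc -> C} := mem sym_polydisc_algebra.

Record Asym : Type := MkAsym {
  Asym_fun :> cpolydisc -> C ;
  Asym_funP : Asym_fun \in Asym_pred
}.

Lemma polydisc_sub : polydisc `<=` cpolydisc.
Proof. by move=> z zD j; exact/subset_closure/zD. Qed.

Lemma polydisc_col_perm (s : 'S_d) z : polydisc z -> polydisc (col_perm s z).
Proof. by move=> zD j; rewrite mxE; exact: zD. Qed.

Lemma evalcE f (z : 'rV[C]_d) : evalc f z = oapp f 0 (insub z).
Proof. by []. Qed.

Lemma evalc_in f (x : cpolydisc) : evalc f (val x) = f x.
Proof. by rewrite evalcE valK. Qed.

Lemma evalcB f g : evalc (f - g) = evalc f - evalc g.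
Proof.
apply/funext => z; rewrite !fctE !evalcE.
by case: insubP => //= _; rewrite subr0.
Qed.

Lemma evalcM f g : evalc (f * g) = evalc f * evalc g.
Proof.
apply/funext => z; rewrite !fctE !evalcE.
by case: insubP => //= _; rewrite mulr0.
Qed.

Lemma evalc1 z : polydisc z -> evalc 1 z = 1.
Proof.
by move=> /polydisc_sub /mem_set zD; rewrite evalcE insubT.
Qed.

Lemma open_disc : open disc.
Proof.
rewrite (_ : disc = ball (0 : C) 1); first exact: ball_open.
by rewrite -ball_normE; apply/seteqP; split=> z /=; rewrite sub0r normrN.
Qed.

Lemma open_polydisc : open polydisc.
Proof.
rewrite openE => z zD; rewrite /interior.
have H j : nbhs z [set w : 'rV[C]_d | disc (w ord0 j)].
  have /= := @coord_continuous C 1 d ord0 j z.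
  apply; apply: open_nbhs_nbhs; split; [exact: open_disc|exact: zD].
exact: (filter_forall _ H).
Qed.

Lemma near_eq_differentiable (V W : normedModType C) (f g : V -> W) (x : V) :
  {near x, f =1 g} -> differentiable f x -> differentiable g x.
Proof.
move=> fg df; have fgx : f x = g x by exact: nbhs_singleton fg.
have cdf := diff_continuous df.
have dg : g \o shift x = cst (g x) + 'd f x +o_ 0 id.
  apply/eqaddoP => _ /posnumP[e].
  have /eqaddoP /(_ e%:num) := diff_locally df.
  have fg0 : \forall h \near (0 : V), f (h + x) = g (h + x).
    have : (fun h : V => h + x) @ (0 : V) --> 0 + x.
      by apply: cvgD; [exact: cvg_id|exact: cvg_cst].
    by rewrite add0r => /(_ _ fg).
  move=> /(_ (gt0 _)); apply: filterS2 fg0 => h fgh.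
  by rewrite /= !fctE /= fgh fgx.
by apply/diff_locallyP; rewrite (diff_unique cdf dg).
Qed.

Lemma Asym_subring_closed : subring_closed Asym_pred.
Proof.
split.
- apply/mem_set; split; first split.
  + move=> z zD; apply: (@near_eq_differentiable 'rV[C]_d C (cst 1)).
      have := open_polydisc; rewrite openE => /(_ _ zD).
      by apply: filterS => w wD; rewrite evalc1.
    exact: differentiable_cst.
  + exact: cst_continuous.
  + by move=> s z zD; rewrite !evalc1//; exact: polydisc_col_perm.
- move=> f g /set_mem [[hf cf] sf] /set_mem [[hg cg] sg].
  apply/mem_set; split; first split.
  + by move=> z zD; rewrite evalcB; apply: differentiableB;
      [exact: hf|exact: hg].
  + by move=> x; apply: continuousB; [exact: cf|exact: cg].
  + move=> s z zD; rewrite evalcB.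
    exact: (congr2 (fun a b => a - b) (sf s z zD) (sg s z zD)).
- move=> f g /set_mem [[hf cf] sf] /set_mem [[hg cg] sg].
  apply/mem_set; split; first split.
  + by move=> z zD; rewrite evalcM; apply: differentiableM;
      [exact: hf|exact: hg].
  + by move=> x; apply: continuousM; [exact: cf|exact: cg].
  + move=> s z zD; rewrite evalcM.
    exact: (congr2 (fun a b => a * b) (sf s z zD) (sg s z zD)).
Qed.

HB.instance Definition _ :=
  GRing.isSubringClosed.Build (cpolydisc -> C) Asym_pred Asym_subring_closed.

HB.instance Definition _ := [isSub for Asym_fun].
HB.instance Definition _ := [Choice of Asym by <:].
HB.instance Definition _ :=
  GRing.SubChoice_isSubComPzRing.Build _ _ Asym (GRing.subringClosedP _).

End PolydiscAlgebra.

Arguments disc R z : clear implicits.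
Arguments polydisc R d z : clear implicits.
Arguments cpolydisc R d z : clear implicits.
Arguments polydisc_algebra R d f : clear implicits.
Arguments sym_polydisc_algebra R d f : clear implicits.

(* Main.v *)
Require Import Defs.
From mathcomp Require Import all_boot all_order all_algebra all_fingroup.
From mathcomp Require Import all_classical all_reals all_analysis.
From mathcomp Require Import complex ring lra.

(** The ring is a domain of functions, so what has to fail is the clause on
intersections. Let w(z) be the mean of the numbers 1 - z_j. It is symmetric,
it maps the open and the closed polydisc into the open and the closed right
half-plane, and it maps the diagonal of the closed polydisc onto the disc
|1 - w| <= 1. Hence every function F that is holomorphic on the open right
half-plane and continuous on the closed one gives an element F(w(z)) of the
ring ([lift]), and every dimension d reduces to this one-variable situation.

Take S(w) = exp(-1/w), which is bounded by 1 on the right half-plane but has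
no limit at 0, and consider the principal ideals generated by f = w and
g = w S(w). An element b g lies in (f) exactly when b S belongs to the ring.
Along the horocycle Re(1/w) = c the modulus of S is constantly exp(-c), so
continuity of both b and b S at w = 0 forces b = 0 there
([conductor_vanish]). Conversely, k S belongs to the ring whenever k(0) = 0
([halfplane_algebra_inner_exp]).

So a finite set of generators of the intersection has the form b_i g where
all the b_i vanish at w = 0. They tend to 0 at some rate, and a function k can
be built that vanishes at 0 more slowly: choose e_n > 0 tending to 0 with
|b_i(e_n)| <= 8^-n for all i, and put
k(w) = sum_n 4^-n w / (w + e_n), which belongs to the ring, vanishes at 0 and
is at least 4^-n / 2 at e_n ([slow]). Then k g lies in the intersection, but
k = sum_i c_i b_i would give 2^n / 2 <= sum_i |c_i(e_n)|, although the
right-hand side converges as e_n tends to 0 ([conductor_not_fg]). *)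

Set Implicit Arguments.
Unset Strict Implicit.
Unset Printing Implicit Defensive.

Import Order.TTheory GRing.Theory Num.Theory.
Import numFieldNormedType.Exports.
Import Normc.

Local Open Scope classical_set_scope.
Local Open Scope ring_scope.
Local Open Scope complex_scope.

Local Notation Re := complex.Re.
Local Notation Im := complex.Im.

(** * Modulus and convergence in R[i] *)

Section ComplexModulus.
Variable R : realType.
Implicit Types z w : R[i].

Lemma normrE z : `|z| = ((normc z)%:C : R[i]) :> R[i]. Proof. by []. Qed.

Lemma normc_ge0 z : 0 <= normc z.
Proof. by rewrite -lecR -normrE normr_ge0. Qed.

Lemma normc_real (r : R) : normc r%:C = `|r|.
Proof. by rewrite /= expr0n addr0 sqrtr_sqr. Qed.

Lemma Re_le_normc z : `|Re z| <= normc z.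
Proof. by rewrite -lecR; exact: normc_ge_Re. Qed.

Lemma Im_le_normc z : `|Im z| <= normc z.
Proof. by case: z => a b; rewrite /= -sqrtr_sqr ler_wsqrtr// lerDr sqr_ge0. Qed.

Lemma normc_le_ReIm z : normc z <= `|Re z| + `|Im z|.
Proof.
rewrite [z]complexE (le_trans (le_normcD _ _))// normcM !normc_real -complexE.
by rewrite /= expr0n expr1n add0r sqrtr1 mul1r.
Qed.

Lemma normc_gt0 z : (0 < normc z) = (z != 0).
Proof. by rewrite -ltcR -normrE normr_gt0. Qed.

Lemma ReD z w : Re (z + w) = Re z + Re w.
Proof. by case: z; case: w. Qed.

Lemma ReN z : Re (- z) = - Re z.
Proof. by case: z. Qed.

Lemma ImD z w : Im (z + w) = Im z + Im w.
Proof. by case: z; case: w. Qed.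

Lemma ImN z : Im (- z) = - Im z.
Proof. by case: z. Qed.

Lemma Re_sum (I : Type) (r : seq I) (P : pred I) (u : I -> R[i]) :
  Re (\sum_(i <- r | P i) u i) = \sum_(i <- r | P i) Re (u i).
Proof. by apply: (big_morph _ ReD). Qed.

Lemma Im_sum (I : Type) (r : seq I) (P : pred I) (u : I -> R[i]) :
  Im (\sum_(i <- r | P i) u i) = \sum_(i <- r | P i) Im (u i).
Proof. by apply: (big_morph _ ImD). Qed.

Lemma normc_sum (I : Type) (r : seq I) (P : pred I) (u : I -> R[i]) :
  normc (\sum_(i <- r | P i) u i) <= \sum_(i <- r | P i) normc (u i).
Proof.
elim/big_rec2: _ => [|i y x _ H]; first by rewrite normc0.
by rewrite (le_trans (le_normcD _ _))// lerD2l.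
Qed.

(** A positive element of R[i] is real, so real epsilons and the real-valued
modulus determine convergence in R[i]. *)
Lemma cvgcP (T : Type) (F : set_system T) (FF : Filter F) (f : T -> R[i]) l :
  f @ F --> l <-> forall e : R, 0 < e -> \forall x \near F, normc (l - f x) < e.
Proof.
split=> [/cvgrPdist_lt fl e e0|fl].
  have /fl : 0 < e%:C by rewrite ltcR.
  by apply: filterS => x; rewrite normrE ltcR.
apply/cvgrPdist_lt => e; rewrite ltcE /= => /andP[/eqP e2 e1].
by apply: filterS (fl _ e1) => x; rewrite normrE ltcE /= e2 eqxx.
Qed.

Lemma nbhscP w (P : set R[i]) :
  nbhs w P <-> exists2 e : R, 0 < e & forall z, normc (w - z) < e -> P z.
Proof.
split=> [/nbhs_normP[e /=]|[e e0 eP]].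
  rewrite ltcE /= => /andP[/eqP e2 e1] eP; exists (Re e) => // z wz.
  by apply: eP; rewrite /ball_/= normrE ltcE /= e2 eqxx.
apply/nbhs_normP; exists e%:C; first by rewrite /= ltcR.
by move=> z /=; rewrite normrE ltcR; exact: eP.
Qed.

Lemma cvg_Re (T : Type) (F : set_system T) (FF : Filter F) (f : T -> R[i]) l :
  f @ F --> l -> (fun x => Re (f x)) @ F --> Re l.
Proof.
move=> /cvgcP fl; apply/cvgrPdist_lt => e /fl; apply: filterS => x.
by apply: le_lt_trans; rewrite -ReN -ReD; exact: Re_le_normc.
Qed.

Lemma cvg_normc (T : Type) (F : set_system T) (FF : Filter F) (f : T -> R[i]) l :
  f @ F --> l -> (fun x => normc (f x)) @ F --> normc l.
Proof. by move=> /cvg_norm; exact: cvg_Re. Qed.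

Lemma cvg_complex (T : Type) (F : set_system T) (FF : Filter F) (f : T -> R[i])
    (a b : R) :
  (fun x => Re (f x)) @ F --> a -> (fun x => Im (f x)) @ F --> b ->
  f @ F --> a +i* b.
Proof.
move=> /cvgrPdist_lt fa /cvgrPdist_lt fb; apply/cvgcP => e e0.
have e2 : 0 < e / 2 by rewrite divr_gt0.
move: (fa _ e2) (fb _ e2); apply: filterS2 => x ax bx.
rewrite (le_lt_trans (normc_le_ReIm _))// ReD ReN ImD ImN /=.
by rewrite [e]splitr ltrD.
Qed.

End ComplexModulus.

(** * Geometrically dominated complex series *)

Section ComplexSeries.
Variable R : realType.
Implicit Types u v : nat -> R[i].

Lemma cvg_half : (GRing.exp 2^-1 : R^nat) @ \oo --> (0 : R).
Proof. by apply: cvg_expr; rewrite ger0_norm ?invr_ge0// invf_lt1// ltr1n. Qed.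

Lemma sum_half_le2 (n : nat) : \sum_(0 <= k < n) (2^-1 : R) ^+ k <= 2.
Proof.
have H : \sum_(0 <= k < n) (2^-1 : R) ^+ k = 2 - 2 * 2^-1 ^+ n.
  elim: n => [|n IH]; first by rewrite big_nil expr0 mulr1 subrr.
  rewrite big_nat_recr//= IH exprS mulrA divff// mul1r; lra.
by rewrite H gerBl mulr_ge0// exprn_ge0// invr_ge0.
Qed.

Lemma cvg_dominated_series (a : nat -> R) (M : R) :
  (forall n, `|a n| <= M * 2^-1 ^+ n) -> cvgn (series a).
Proof.
move=> aM; apply: normed_cvg.
apply: (@series_le_cvg _ _ (geometric M 2^-1)) => //.
- by move=> n; exact: normr_ge0.
- by move=> n; exact: le_trans (normr_ge0 _) (aM n).
by apply: is_cvg_geometric_series; rewrite ger0_norm ?invr_ge0// invf_lt1// ltr1n.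
Qed.

Definition csum u : R[i] := limn (series u).

(** Completeness of the reals is applied to the real and the imaginary parts. *)
Lemma is_cvg_csum u (M : R) :
  (forall n, normc (u n) <= M * 2^-1 ^+ n) -> cvgn (series u).
Proof.
move=> uM.
have /cvg_ex[a ca] : cvgn (series (fun n => Re (u n))).
  by apply: (@cvg_dominated_series _ M) => n; apply: le_trans (uM n); exact: Re_le_normc.
have /cvg_ex[b cb] : cvgn (series (fun n => Im (u n))).
  by apply: (@cvg_dominated_series _ M) => n; apply: le_trans (uM n); exact: Im_le_normc.
apply/cvg_ex; exists (a +i* b); apply: cvg_complex.
- suff -> : (fun n => Re (series u n)) = series (fun n => Re (u n)) by [].
  by apply/funext => n; exact: Re_sum.
- suff -> : (fun n => Im (series u n)) = series (fun n => Im (u n)) by [].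
  by apply/funext => n; exact: Im_sum.
Qed.

Lemma normc_csum_le u (M : R) :
  (forall n, normc (u n) <= M * 2^-1 ^+ n) -> normc (csum u) <= 2 * M.
Proof.
move=> uM; have /cvg_normc cu := is_cvg_csum uM.
rewrite -[leLHS](cvg_lim _ cu)//.
apply: limr_le; first by apply/cvg_ex; exists (normc (csum u)); exact: cu.
apply: nearW => n; rewrite seriesEnat /= (le_trans (normc_sum _ _ _))//.
rewrite (@le_trans _ _ (\sum_(0 <= k < n) M * 2^-1 ^+ k))//.
  by apply: ler_sum => k _.
rewrite -mulr_sumr mulrC ler_wpM2r ?sum_half_le2//.
by have := uM 0%N; rewrite expr0 mulr1; exact/le_trans/normc_ge0.
Qed.

Lemma csum_linear u v (M N : R) (c : R[i]) :
  (forall n, normc (u n) <= M * 2^-1 ^+ n) ->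
  (forall n, normc (v n) <= N * 2^-1 ^+ n) ->
  csum (fun n => u n - c * v n) = csum u - c * csum v.
Proof.
move=> /is_cvg_csum cu /is_cvg_csum cv.
have -> : csum (fun n => u n - c * v n) =
    limn (fun n => series u n - c * series v n).
  congr (limn _); apply/funext => n.
  by rewrite /series /= mulr_sumr -sumrB.
apply: cvg_lim; first by [].
by apply: cvgB; [exact: cu|apply: cvgMl_tmp; exact: cv].
Qed.

(** Nonnegative real parts exclude cancellation. *)
Lemma Re_csum_ge u (M : R) (m : nat) :
  (forall n, normc (u n) <= M * 2^-1 ^+ n) -> (forall n, 0 <= Re (u n)) ->
  Re (u m) <= Re (csum u).
Proof.
move=> uM u0; have /cvg_Re cu := is_cvg_csum uM.
rewrite -[leRHS](cvg_lim _ cu)//.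
apply: limr_ge; first by apply/cvg_ex; exists (Re (csum u)); exact: cu.
exists m.+1 => // n /= mn; rewrite seriesEnat Re_sum (bigD1_seq m)/= ?iota_uniq//.
  by rewrite lerDl sumr_ge0.
by rewrite mem_index_iota.
Qed.

End ComplexSeries.

(** * Holomorphy and the complex exponential *)

Section Holomorphy.
Variable R : realType.
Implicit Types (F : R[i] -> R[i]) (w h : R[i]).

(** Both for the exponential and for the sum of a series of rational functions,
the first-order Taylor remainder has an explicit quadratic bound, which gives
holomorphy without Cauchy's integral formula. *)
Lemma differentiable_quadratic F w l (K r : R) : 0 < r ->
  (forall h, normc h < r ->
     normc (F (w + h) - F w - l * h) <= K * normc h ^+ 2) ->
  differentiable F w.
Proof.
move=> r0 FK; apply/derivable1_diffP; apply/cvg_ex; exists l.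
apply/cvgcP => e e0.
(* the 1 keeps the denominator positive when K = 0 *)
pose d := Num.min r (e / (`|K| + 1)).
have K0 : 0 < `|K| + 1 by rewrite ltr_wpDl.
have d0 : 0 < d by rewrite lt_min r0 divr_gt0.
have : \forall h \near (0 : R[i])^', normc h < d /\ h != 0.
  apply/nbhscP; exists d => // h; rewrite sub0r normcN => hd h0.
  by split.
apply: filterS => h [hd h0].
have nh : 0 < normc h by rewrite normc_gt0.
have /FK : normc h < r by rewrite (lt_le_trans hd)// ge_min lexx.
have -> : l - h^-1 *: ((F \o shift w) (h *: 1) - F w) =
   - (h^-1 * (F (w + h) - F w - l * h)).
  rewrite /= scaler1 [h + w]addrC.
  change (l - h^-1 * (F (w + h) - F w) = - (h^-1 * (F (w + h) - F w - l * h))).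
  by field.
move=> Fh; rewrite normcN normcM normcV mulrC ltr_pdivrMr//.
apply: (le_lt_trans Fh); rewrite expr2 mulrA ltr_pM2r//.
rewrite (@le_lt_trans _ _ ((`|K| + 1) * normc h))//.
  by rewrite ler_wpM2r ?normc_ge0// (le_trans (ler_norm _))// lerDl.
by rewrite mulrC -ltr_pdivlMr// (lt_le_trans hd)// ge_min lexx orbT.
Qed.

End Holomorphy.

Section ComplexExponential.
Variable R : realType.
Implicit Types (x y : R) (z h : R[i]).

Definition cexp z : R[i] :=
  (expR (Re z))%:C * (cos (Im z) +i* sin (Im z)).

Lemma normc_cexp z : normc (cexp z) = expR (Re z).
Proof.
by rewrite normcM normc_real /= cos2Dsin2 sqrtr1 mulr1 ger0_norm// expR_ge0.
Qed.

Lemma cexpD z h : cexp (z + h) = cexp z * cexp h.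
Proof.
rewrite /cexp ReD ImD expRD cosD sinD rmorphM/=.
rewrite mulrACA; congr (_ * _); apply/eqP; rewrite eq_complex /=.
by apply/andP; split; apply/eqP => //; ring.
Qed.

Lemma MVT0 (f df : R -> R) y : (forall x, is_derive x (1 : R) f (df x)) ->
  exists2 c : R, `|c| <= `|y| & f y - f 0 = df c * y.
Proof.
move=> fdf.
have fc x : {for x, continuous f}.
  by apply/differentiable_continuous/derivable1_diffP; apply: ex_derive.
have fcw (A : set R) : {within A, continuous f} by apply: continuous_subspaceT.
have [y0|/ltW y0] := leP 0 y.
- have [c] := MVT_segment y0 (fun x _ => fdf x) (fcw _).
  rewrite in_itv /= subr0 => /andP[c0 cy] e; exists c => //.
  by rewrite !ger0_norm// (le_trans c0).
- have [c] := MVT_segment y0 (fun x _ => fdf x) (fcw _).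
  rewrite in_itv /= => /andP[c0 cy] e; exists c.
    by rewrite !ler0_norm ?lerN2.
  by rewrite -opprB e; ring.
Qed.

Lemma normr_sin_le y : `|sin y| <= `|y|.
Proof.
have [c _] := @MVT0 sin cos y _; rewrite sin0 subr0 => ->.
by rewrite normrM ler_piMl// cos_max.
Qed.

Lemma normr_cos_sub1_le y : `|cos y - 1| <= y ^+ 2.
Proof.
have [c cy] := @MVT0 cos (fun x => - sin x) y _; rewrite cos0 => ->.
rewrite normrM normrN -(real_normK (num_real y)) expr2 ler_wpM2r//.
exact: le_trans (normr_sin_le _) cy.
Qed.

Lemma normr_sin_sub_le y : `|y| <= 1 -> `|sin y - y| <= y ^+ 2.
Proof.
move=> y1; have [c cy] := @MVT0 (fun x => sin x - x) (fun x => cos x - 1) y _.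
rewrite sin0 subrr subr0 => ->.
rewrite normrM -(real_normK (num_real y)) expr2 ler_wpM2r ?normr_ge0//.
rewrite (le_trans (normr_cos_sub1_le c))// -(real_normK (num_real c)).
by rewrite (le_trans _ cy)// expr2 ler_piMl// (le_trans cy).
Qed.

(** The bound 1 + t <= exp t is used at t = x and, for the upper estimate, at
t = - x, where it gives exp x (1 - x) <= 1. *)
Lemma normr_expR_sub_le x : `|x| <= 2^-1 -> `|expR x - 1 - x| <= 2 * x ^+ 2.
Proof.
rewrite ler_norml => /andP[x1 x2].
have h1 := expR_ge1Dx x; have h2 := expR_ge1Dx (- x).
have h3 : expR x * expR (- x) = 1 by rewrite -expRD subrr expR0.
have h4 := expR_gt0 x.
rewrite ger0_norm; last lra.
have h5 : expR x * (1 - x) <= 1 by rewrite -[leRHS]h3 ler_wpM2l// ltW.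
nra.
Qed.

(** With h = x + iy, both parts of the remainder are rearranged into products of
the real remainders exp x - 1 - x, cos y - 1 and sin y - y. *)
Lemma normc_cexp_sub_le h : normc h < 2^-1 ->
  normc (cexp h - 1 - h) <= 8 * normc h ^+ 2.
Proof.
move=> h2; have hx := Re_le_normc h; have hy := Im_le_normc h.
rewrite (le_trans (normc_le_ReIm _))//.
have -> : Re (cexp h - 1 - h) = expR (Re h) * cos (Im h) - 1 - Re h.
  by case: h {h2 hx hy} => a b /=; ring.
have -> : Im (cexp h - 1 - h) = expR (Re h) * sin (Im h) - Im h.
  by case: h {h2 hx hy} => a b /=; ring.
move: (Re h) (Im h) (normc h) hx hy h2 => x y N hx hy h2.
have ex : `|expR x - 1 - x| <= 2 * x ^+ 2 by apply: normr_expR_sub_le; lra.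
have sy : `|sin y - y| <= y ^+ 2 by apply: normr_sin_sub_le; lra.
have cy := normr_cos_sub1_le y.
have c1 := cos_max y.
have sy' := normr_sin_le y.
have N0 : 0 <= N by exact: le_trans hx.
have x2 : x ^+ 2 <= N ^+ 2.
  by rewrite -(real_normK (num_real x)) ler_pXn2r ?nnegrE.
have y2 : y ^+ 2 <= N ^+ 2.
  by rewrite -(real_normK (num_real y)) ler_pXn2r ?nnegrE.
have H1 : `|expR x * cos y - 1 - x| <= 2 * N ^+ 2 + 2 * N ^+ 2.
  have -> : expR x * cos y - 1 - x =
    (expR x - 1 - x) * cos y + (1 + x) * (cos y - 1) by ring.
  rewrite (le_trans (ler_normD _ _))// !normrM lerD//.
    rewrite -[leRHS]mulr1 ler_pM//; lra.
  rewrite ler_pM//; last lra.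
  rewrite (le_trans (ler_normD _ _))// normr1; lra.
have H2 : `|expR x * sin y - y| <= 2 * N * N + N ^+ 2.
  have -> : expR x * sin y - y = (expR x - 1) * sin y + (sin y - y) by ring.
  rewrite (le_trans (ler_normD _ _))// !normrM lerD//; last lra.
  rewrite ler_pM//; last lra.
  have -> : expR x - 1 = expR x - 1 - x + x by ring.
  rewrite (le_trans (ler_normD _ _))//.
  have : x ^+ 2 <= N * 2^-1.
    rewrite (le_trans x2)// expr2 ler_wpM2l// ltW//.
  lra.
rewrite (le_trans (lerD H1 H2))//; nra.
Qed.

(** The functional equation reduces the remainder at z to the one at 0. *)
Lemma differentiable_cexp z : differentiable cexp z.
Proof.
apply: (@differentiable_quadratic _ _ _ (cexp z) (expR (Re z) * 8) 2^-1).
  by rewrite invr_gt0.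
move=> h h2; rewrite cexpD.
have -> : cexp z * cexp h - cexp z - cexp z * h = cexp z * (cexp h - 1 - h).
  by ring.
rewrite normcM normc_cexp -mulrA ler_wpM2l ?expR_ge0//.
exact: normc_cexp_sub_le.
Qed.

End ComplexExponential.

(** * The half-plane algebra and the inner function exp(-1/w) *)

Section HalfPlaneAlgebra.
Variable R : realType.
Implicit Types (F : R[i] -> R[i]) (w : R[i]).

Definition rhp : set R[i] := [set w | 0 <= Re w].

Definition halfplane_algebra F : Prop :=
  (forall w, 0 < Re w -> differentiable F w) /\
  (forall w, rhp w -> F @ within rhp (nbhs w) --> F w).

Lemma halfplane_algebra_id : halfplane_algebra id.
Proof.
split=> [w _|w _]; first by apply: ex_diff.
exact/cvg_within.
Qed.

Lemma Re_inv w : Re w^-1 = Re w / normc w ^+ 2.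
Proof.
case: w => a b; rewrite /= sqr_sqrtr ?addr_ge0 ?sqr_ge0//.
Qed.

Definition inner_exp w := cexp (- w^-1).

Lemma normc_inner_exp w : normc (inner_exp w) = expR (- Re w^-1).
Proof. by rewrite normc_cexp ReN. Qed.

Lemma normc_inner_exp_le1 w : rhp w -> normc (inner_exp w) <= 1.
Proof.
move=> w0; rewrite normc_inner_exp -expR0 ler_expR oppr_le0 Re_inv.
by rewrite divr_ge0// exprn_ge0// normc_ge0.
Qed.

Lemma differentiable_inner_exp w : w != 0 -> differentiable inner_exp w.
Proof.
move=> w0; have dV : differentiable (fun z : R[i] => - z^-1) w.
  by apply: differentiableN; exact: differentiable_Rinv.
exact: (differentiable_comp dV (differentiable_cexp _)).
Qed.

(** The factor exp(-1/w) is discontinuous only at 0; it is bounded by 1, so a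
function that vanishes at 0 absorbs the discontinuity. *)
Lemma halfplane_algebra_inner_exp F : halfplane_algebra F -> F 0 = 0 ->
  halfplane_algebra (fun w => inner_exp w * F w).
Proof.
move=> [dF cF] F0; split=> w w0.
  apply: differentiableM; last exact: dF.
  by apply: differentiable_inner_exp; apply: contraTneq w0 => ->; rewrite ltxx.
have [we|wn] := eqVneq w 0.
  rewrite we F0 mulr0; apply/cvgcP => e e0.
  have /cvgcP /(_ _ e0) := cF w w0; rewrite we F0.
  have : \forall x \near within rhp (nbhs (0 : R[i])), rhp x by exact: withinT.
  apply: filterS2 => z z0; apply: le_lt_trans; rewrite !sub0r !normcN normcM.
  by rewrite ler_piMl ?normc_ge0// normc_inner_exp_le1.
apply: cvgM; last exact: cF.
have /differentiable_continuous := differentiable_inner_exp wn.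
by move=> c; apply: (cvg_trans _ c); apply: cvg_app; exact: cvg_within.
Qed.

End HalfPlaneAlgebra.

Arguments rhp {R} _.

(** * Functions that vanish slowly at 0 *)

Section SlowDecay.
Variable R : realType.
Implicit Types (w h : R[i]) (e : R).

(** Adding e > 0 moves a point of the right half-plane away from 0 in modulus;
the estimates on w / (w + e) rest on this. *)
Lemma le_normc_rhp_add w e : rhp w -> 0 < e ->
  normc w <= normc (w + e%:C) /\ e <= normc (w + e%:C).
Proof.
move=> w0 e0; split; last first.
  apply: le_trans (Re_le_normc _); apply: le_trans (ler_norm _).
  by rewrite ReD /= lerDr.
case: w w0 => a b; rewrite /rhp /= addr0 => a0.
by rewrite ler_wsqrtr// lerD2r ler_pXn2r ?nnegrE ?addr_ge0 ?lerDl// ltW.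
Qed.

Lemma rhp_add_neq0 w e : rhp w -> 0 < e -> w + e%:C != 0.
Proof.
move=> w0 e0; rewrite -normc_gt0.
by have [_] := le_normc_rhp_add w0 e0; exact: lt_le_trans.
Qed.

Definition moebius e w : R[i] := w / (w + e%:C).

Lemma normc_moebius_le1 e w : rhp w -> 0 < e -> normc (moebius e w) <= 1.
Proof.
move=> w0 e0; have [h1 h2] := le_normc_rhp_add w0 e0.
by rewrite normcM normcV ler_pdivrMr ?mul1r// (lt_le_trans e0).
Qed.

Lemma normc_moebius_le e w : rhp w -> 0 < e -> normc (moebius e w) <= normc w / e.
Proof.
move=> w0 e0; have [h1 h2] := le_normc_rhp_add w0 e0.
by rewrite normcM normcV ler_wpM2l ?normc_ge0// lef_pV2 ?posrE// (lt_le_trans e0).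
Qed.

Lemma normc_moebius_sub_le e w z : rhp w -> rhp z -> w != 0 -> 0 < e ->
  normc (moebius e w - moebius e z) <= normc (w - z) / normc w.
Proof.
move=> w0 z0 wn e0; have [h1 h2] := le_normc_rhp_add w0 e0.
have [k1 k2] := le_normc_rhp_add z0 e0.
have nw : 0 < normc w by rewrite normc_gt0.
have -> : moebius e w - moebius e z =
    (w - z) * ((w + e%:C)^-1 * (e%:C * (z + e%:C)^-1)).
  rewrite /moebius; field.
  by apply/andP; split; apply: rhp_add_neq0.
rewrite normcM ler_wpM2l ?normc_ge0// normcM !normcM !normcV -[leRHS]mulr1.
rewrite ler_pM ?mulr_ge0 ?invr_ge0 ?normc_ge0//.
  by rewrite lef_pV2 ?posrE// (lt_le_trans nw).
by rewrite normc_real ger0_norm ?(ltW e0)// ler_pdivrMr ?mul1r// (lt_le_trans e0).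
Qed.

(** The derivative of [moebius e]. *)
Definition dmoebius e w : R[i] := e%:C / (w + e%:C) ^+ 2.

Lemma normc_dmoebius_le e w : 0 < Re w -> 0 < e ->
  normc (dmoebius e w) <= (Re w)^-1.
Proof.
move=> w0 e0; have [h1 h2] := le_normc_rhp_add (ltW w0) e0.
have h3 : Re w <= normc w by apply: le_trans (Re_le_normc _); exact: ler_norm.
rewrite /dmoebius expr2 invfM mulrA normcM normcM !normcV -[leRHS]mul1r.
rewrite ler_pM ?mulr_ge0 ?invr_ge0 ?normc_ge0//.
  by rewrite normc_real ger0_norm ?(ltW e0)// ler_pdivrMr ?mul1r// (lt_le_trans e0).
rewrite lef_pV2 ?posrE//; first exact: le_trans h1.
exact: lt_le_trans h2.
Qed.

Lemma Re_add_ge w h : normc h < Re w / 2 -> Re w / 2 <= Re (w + h).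
Proof.
move=> hw; have := Re_le_normc h; rewrite ReD ler_norml => /andP[H _].
move: hw H; move: (Re w) (Re h) (normc h) => a b c; lra.
Qed.

Lemma normc_moebius_taylor_le e w h : 0 < Re w -> 0 < e ->
  normc h < Re w / 2 ->
  normc (moebius e (w + h) - moebius e w - h * dmoebius e w)
  <= 2 / Re w ^+ 2 * normc h ^+ 2.
Proof.
move=> w0 e0 hw.
have whr := Re_add_ge hw.
have wh0 : 0 < Re (w + h) by apply: lt_le_trans whr; rewrite divr_gt0.
have [k1 _] := le_normc_rhp_add (ltW wh0) e0.
have -> : moebius e (w + h) - moebius e w - h * dmoebius e w =
   - (dmoebius e w * (w + h + e%:C)^-1 * (h * h)).
  rewrite /moebius /dmoebius; field.
  by apply/andP; split; apply: rhp_add_neq0 => //; exact: ltW.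
rewrite normcN normcM (normcM h) -expr2 ler_wpM2r ?exprn_ge0 ?normc_ge0//.
have -> : 2 / Re w ^+ 2 = (Re w)^-1 * (Re w / 2)^-1.
  by field; rewrite gt_eqF.
rewrite normcM ler_pM ?normc_ge0 ?normc_dmoebius_le//.
rewrite normcV lef_pV2 ?posrE ?divr_gt0//; last first.
  by rewrite normc_gt0 rhp_add_neq0//; exact: ltW.
rewrite (le_trans whr)// (le_trans _ k1)//.
by apply: le_trans (Re_le_normc _); exact: ler_norm.
Qed.

Variable eps : nat -> R.
Hypothesis eps_gt0 : forall n, 0 < eps n.

Let q (n : nat) : R := 2^-1 ^+ n.

Let q_ge0 n : 0 <= q n. Proof. by rewrite exprn_ge0// invr_ge0. Qed.

Let q_le1 n : q n <= 1.
Proof. by rewrite exprn_ile1 ?invr_ge0// invf_le1// ler1n. Qed.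

Let normc_weight n z : normc ((q n ^+ 2)%:C * z) = q n ^+ 2 * normc z.
Proof. by rewrite normcM normc_real ger0_norm// exprn_ge0. Qed.

Let weight_le n (M x : R) : 0 <= x -> x <= M -> q n ^+ 2 * x <= M * q n.
Proof.
move=> x0 xM; rewrite mulrC ler_pM ?exprn_ge0//.
by rewrite expr2 ler_piMl.
Qed.

(** The weights are 4^-n, written as squares: one factor 2^-n makes the series
converge, the other one is spent on continuity at 0. *)
Definition slow w : R[i] := csum (fun n => (q n ^+ 2)%:C * moebius (eps n) w).

Let slow_bound w : rhp w ->
  forall n, normc ((q n ^+ 2)%:C * moebius (eps n) w) <= 1 * 2^-1 ^+ n.
Proof.
move=> w0 n; rewrite normc_weight weight_le ?normc_ge0//.
exact: normc_moebius_le1.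
Qed.

Let slow_sub w z : rhp w -> rhp z ->
  slow w - slow z =
  csum (fun n => (q n ^+ 2)%:C * moebius (eps n) w
                 - 1 * ((q n ^+ 2)%:C * moebius (eps n) z)).
Proof.
move=> w0 z0.
by rewrite (csum_linear _ (slow_bound w0) (slow_bound z0)) mul1r.
Qed.

Lemma slow0 : slow 0 = 0.
Proof.
have : normc (slow 0) <= 2 * 0.
  apply: normc_csum_le => n.
  by rewrite /moebius mul0r mulr0 normc0 mul0r.
rewrite mulr0 => le0; apply: eq0_normc; apply/eqP.
by rewrite eq_le le0 normc_ge0.
Qed.

Lemma differentiable_slow w : 0 < Re w -> differentiable slow w.
Proof.
move=> w0; pose M := 2 / Re w ^+ 2.
pose l := csum (fun n => (q n ^+ 2)%:C * dmoebius (eps n) w).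
apply: (@differentiable_quadratic _ _ _ l (2 * M) (Re w / 2)).
  by rewrite divr_gt0.
move=> h hw.
have whr := Re_add_ge hw.
have wh0 : 0 < Re (w + h) by apply: lt_le_trans whr; rewrite divr_gt0.
rewrite (slow_sub (ltW wh0) (ltW w0)) mulrC.
have B1 n : normc ((q n ^+ 2)%:C * moebius (eps n) (w + h)
     - 1 * ((q n ^+ 2)%:C * moebius (eps n) w)) <= 2 * 2^-1 ^+ n.
  rewrite mul1r (le_trans (le_normcD _ _))// normcN.
  rewrite [2 * _]mulrDl lerD// slow_bound//; exact: ltW.
have B2 n : normc ((q n ^+ 2)%:C * dmoebius (eps n) w) <= (Re w)^-1 * 2^-1 ^+ n.
  by rewrite normc_weight weight_le ?normc_ge0// normc_dmoebius_le.
rewrite -(csum_linear h B1 B2) -mulrA.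
apply: normc_csum_le => n.
have -> : (q n ^+ 2)%:C * moebius (eps n) (w + h)
     - 1 * ((q n ^+ 2)%:C * moebius (eps n) w)
     - h * ((q n ^+ 2)%:C * dmoebius (eps n) w) =
  (q n ^+ 2)%:C * (moebius (eps n) (w + h) - moebius (eps n) w - h * dmoebius (eps n) w).
  by ring.
rewrite normc_weight weight_le ?normc_ge0//.
exact: normc_moebius_taylor_le.
Qed.

(** Away from 0 the summands are uniformly Lipschitz. At 0 their Lipschitz
constants 1 / eps n may be unbounded, so the summands with n < N are made small by
the choice of the neighbourhood, and the others by their weights. *)
Lemma slow_cvg w : rhp w -> slow @ within rhp (nbhs w) --> slow w.
Proof.
move=> w0; apply/cvgcP => e e0.
have [we|wn] := eqVneq w 0; last first.
  have nw : 0 < normc w by rewrite normc_gt0.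
  apply/nbhscP; exists (e / 4 * normc w); first by rewrite mulr_gt0// divr_gt0.
  move=> z wz z0; rewrite slow_sub//.
  apply: (@le_lt_trans _ _ (2 * (e / 4))); last lra.
  apply: normc_csum_le => n; rewrite mul1r -mulrBr normc_weight.
  rewrite weight_le ?normc_ge0// (le_trans (normc_moebius_sub_le _ _ _ _))//.
  by rewrite ler_pdivrMr// ltW.
subst w; rewrite slow0.
have [N qN] : exists N, q N <= e / 4.
  have e4 : 0 < e / 4 by rewrite divr_gt0.
  have /cvgrPdist_lt /(_ _ e4) [N _ /(_ N)] := @cvg_half R.
  rewrite /= sub0r normrN => H; exists N.
  by rewrite -[leLHS]ger0_norm// ltW// H//= leqnn.
have [r r0 rN] : exists2 r : R, 0 < r & forall n, (n < N)%N -> r <= eps n.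
  elim: (N) => [|m [r r0 rm]]; first by exists 1.
  exists (Num.min r (eps m)); first by rewrite lt_min r0 eps_gt0.
  move=> n; rewrite ltnS leq_eqVlt => /orP[/eqP ->|/rm nm].
    by rewrite ge_min lexx orbT.
  by rewrite ge_min nm.
apply/nbhscP; exists (e / 4 * r); first by rewrite mulr_gt0// divr_gt0.
move=> z; rewrite !sub0r !normcN => zr z0.
apply: (@le_lt_trans _ _ (2 * (e / 4))); last lra.
apply: normc_csum_le => n; rewrite normc_weight.
have [nN|Nn] := ltnP n N.
  rewrite weight_le ?normc_ge0// (le_trans (normc_moebius_le _ _))//.
  rewrite ler_pdivrMr// (le_trans (ltW zr))// ler_wpM2l// ?rN//.
  by rewrite divr_ge0// ltW.
rewrite expr2 -mulrA ler_pM ?mulr_ge0 ?normc_ge0//.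
  by rewrite (le_trans _ qN)// /q ler_wiXn2l ?invr_ge0// invf_le1// ler1n.
by rewrite ler_piMr// normc_moebius_le1.
Qed.

Lemma halfplane_algebra_slow : halfplane_algebra slow.
Proof. by split; [exact: differentiable_slow|exact: slow_cvg]. Qed.

(** At a positive real point all summands are nonnegative, and the summand of
index m equals 4^-m / 2 at eps m. *)
Lemma slow_ge m : 4^-1 ^+ m / 2 <= normc (slow (eps m)%:C).
Proof.
have r0 : rhp (eps m)%:C by rewrite /rhp /= ltW.
apply: le_trans (Re_le_normc _); apply: le_trans (ler_norm _).
have moebius_real n : moebius (eps n) (eps m)%:C = (eps m / (eps m + eps n))%:C.
  by rewrite /moebius -rmorphD -fmorphV -rmorphM.
have e0 n : 0 <= eps n by exact: ltW.
apply: le_trans (Re_csum_ge m (slow_bound r0) _).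
  have -> : (4^-1 : R) = 2^-1 ^+ 2 by field.
  have half : eps m / (eps m + eps m) = 2^-1.
    by field; rewrite gt_eqF//= addr_gt0.
  by rewrite moebius_real half -rmorphM /= -!exprM mulnC.
move=> n; rewrite moebius_real -rmorphM /= mulr_ge0 ?exprn_ge0//.
by rewrite divr_ge0// addr_ge0.
Qed.

End SlowDecay.

(** * From the half-plane to the symmetric polydisc algebra *)

Section SymmetricPolydisc.
Variables (R : realType) (d : nat).
Hypothesis d_gt0 : (0 < d)%N.
Local Notation C := R[i].
Implicit Types (z : 'rV[C]_d) (w : C) (a b : Asym R d).

Lemma normc_closure_disc w : closure (disc R) w -> normc w <= 1.
Proof.
move=> cw; apply/ler_addgt0Pr => e e0.
have /cw[v [/= v1 wv]] : nbhs w [set v | normc (w - v) < e].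
  by apply/nbhscP; exists e.
have {}v1 : normc v < 1 by rewrite -ltcR.
rewrite -[w](subrK v) (le_trans (le_normcD _ _))// addrC lerD//; exact: ltW.
Qed.

(** A point of modulus at most 1 is approximated by its multiples by
1 / (1 + e). *)
Lemma closure_disc w : normc w <= 1 -> closure (disc R) w.
Proof.
move=> w1 B /nbhscP[e e0 eB].
pose t : R := (1 + e)^-1.
have e1 : 0 < 1 + e by rewrite addr_gt0.
have t1 : t < 1 by rewrite invf_lt1// ltrDl.
have t0 : 0 < t by rewrite invr_gt0.
exists (t%:C * w); split.
  rewrite /disc /= normrE ltcR normcM normc_real gtr0_norm//.
  by rewrite (le_lt_trans _ t1)// ler_piMr// ltW.
apply: eB; rewrite -[X in X - _]mul1r -mulrBl normcM.
have -> : 1 - t%:C = (1 - t)%:C :> C by rewrite rmorphB.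
rewrite normc_real ger0_norm ?subr_ge0 ?ltW//.
have te : 1 - t < e.
  have -> : 1 - t = e / (1 + e) by rewrite /t; field; rewrite gt_eqF.
  by rewrite ltr_pdivrMr// mulrDr mulr1 ltrDl mulr_gt0.
by apply: le_lt_trans te; rewrite ler_piMr// subr_ge0 ltW.
Qed.

Definition offset z : C := d%:R^-1 * \sum_(j < d) (1 - z ord0 j).

Let Re_offset z : Re (offset z) = (d%:R)^-1 * \sum_(j < d) (1 - Re (z ord0 j)).
Proof.
rewrite /offset.
have -> : (d%:R^-1 : C) = (d%:R^-1 : R)%:C by rewrite fmorphV rmorph_nat.
have -> (x : R) v : Re (x%:C * v) = x * Re v.
  by case: v => p q /=; rewrite mul0r subr0.
by rewrite Re_sum; congr (_ * _); apply: eq_bigr => j _; rewrite ReD ReN.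
Qed.

Let Re_le1 w : normc w <= 1 -> Re w <= 1.
Proof. by apply: le_trans; apply: le_trans (Re_le_normc _); exact: ler_norm. Qed.

Lemma rhp_offset z : cpolydisc R d z -> rhp (offset z).
Proof.
move=> zD; rewrite /rhp /= Re_offset mulr_ge0 ?invr_ge0 ?ler0n//.
apply: sumr_ge0 => j _; rewrite subr_ge0; apply: Re_le1.
exact/normc_closure_disc/zD.
Qed.

Lemma Re_offset_gt0 z : polydisc R d z -> 0 < Re (offset z).
Proof.
move=> zD; rewrite Re_offset mulr_gt0 ?invr_gt0 ?ltr0n//.
have pos j : 0 < 1 - Re (z ord0 j).
  rewrite subr_gt0; have := zD j; rewrite /disc /= normrE ltcR.
  by apply: le_lt_trans; apply: le_trans (Re_le_normc _); exact: ler_norm.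
rewrite lt_def; apply/andP; split; last first.
  by apply: sumr_ge0 => j _; exact: ltW.
rewrite psumr_neq0; last by move=> j _; exact: ltW.
by apply/hasP; exists (Ordinal d_gt0); rewrite ?mem_index_enum ?pos.
Qed.

Lemma differentiable_offset z : differentiable offset z.
Proof.
have -> : offset = (d%:R^-1 : C) *: (\sum_(j < d) (cst 1 - (fun z => z ord0 j))).
  apply/funext => x; rewrite /offset /= fctE fct_sumE; congr (_ * _).
apply: differentiableZ; apply: differentiable_sum => j.
by apply: differentiableB => //; exact: differentiable_coord.
Qed.

Lemma offset_col_perm (s : 'S_d) z : offset (col_perm s z) = offset z.
Proof.
rewrite /offset [in RHS](reindex_inj (@perm_inj _ s)) /=.
by congr (_ * _); apply: eq_bigr => j _; rewrite mxE.
Qed.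

Lemma sym_polydisc_of_halfplane (F : C -> C) : halfplane_algebra F ->
  sym_polydisc_algebra R d (fun x => F (offset (val x))).
Proof.
move=> [dF cF]; set f := (X in sym_polydisc_algebra _ _ X).
have fE z : cpolydisc R d z -> evalc f z = F (offset z).
  by move=> zD; rewrite evalcE insubT ?inE.
have pE z : polydisc R d z -> evalc f z = F (offset z).
  by move=> zD; rewrite fE//; exact: polydisc_sub.
split; first split.
- move=> z zD; apply: (@near_eq_differentiable _ _ _ (F \o offset)).
    have := open_polydisc (R := R) (d := d); rewrite openE => /(_ _ zD).
    by apply: filterS => x xD; rewrite pE.
  apply: differentiable_comp; first exact: differentiable_offset.
  by apply: dF; exact: Re_offset_gt0.
- have -> : f = sigL (cpolydisc R d) (F \o offset) by [].
  apply/subspace_sigL_continuousP/subspace_continuousP => z zD.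
  apply: cvg_comp (cF _ (rhp_offset zD)) => B /= oB.
  have /differentiable_continuous := differentiable_offset z.
  move=> /(_ _ oB); apply: (@filterS _ (nbhs z)) => x /= xB xD.
  by apply: xB; exact: rhp_offset.
- move=> s z zD.
  by rewrite !pE ?offset_col_perm//; exact: polydisc_col_perm.
Qed.

Definition lift (F : C -> C) (hF : halfplane_algebra F) : Asym R d :=
  MkAsym (mem_set (sym_polydisc_of_halfplane hF)).

Definition disc1 : set C := [set w | normc (1 - w) <= 1].

(** The failure of finite generation is visible on the diagonal
z_1 = ... = z_d = 1 - w, which is parametrised by [disc1] so that
[offset] takes the value w there. *)
Definition diag_eval a w : C := evalc a (const_mx (1 - w)).

Lemma cpolydisc_diag w : disc1 w -> cpolydisc R d (const_mx (1 - w)).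
Proof. by move=> w1 j; rewrite mxE; exact: closure_disc. Qed.

Lemma diag_eval_lift F (hF : halfplane_algebra F) w : disc1 w ->
  diag_eval (lift hF) w = F w.
Proof.
move=> w1; rewrite /diag_eval evalcE insubT ?inE; first exact: cpolydisc_diag.
move=> p; rewrite /= /lift /=; congr F; rewrite /offset.
under eq_bigr => j _ do rewrite mxE subKr.
rewrite sumr_const card_ord -[w *+ d]mulr_natl mulrA mulVf ?mul1r//.
by rewrite pnatr_eq0 -lt0n.
Qed.

Lemma diag_evalM a b w : diag_eval (a * b) w = diag_eval a w * diag_eval b w.
Proof. by rewrite /diag_eval evalcM. Qed.

Lemma diag_eval_sum (I : Type) (r : seq I) (P : pred I) (u : I -> Asym R d) w :
  diag_eval (\sum_(i <- r | P i) u i) w =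
  \sum_(i <- r | P i) diag_eval (u i) w.
Proof.
apply: (big_morph (diag_eval^~ w)) => [a b|].
  by rewrite /diag_eval !evalcE; case: insub => //=; rewrite addr0.
by rewrite /diag_eval !evalcE; case: insub.
Qed.

Lemma cvg_diag w : (fun v : C => const_mx (1 - v) : 'rV[C]_d) @ nbhs w -->
  (const_mx (1 - w) : 'rV[C]_d).
Proof.
apply/cvg_ballP => e e0.
have : \forall v \near w, ball w e v by exact: nbhsx_ballx.
apply: filterS => v wv; split=> // i j; rewrite !mxE.
move: wv; rewrite -!ball_normE /ball_ /=.
have -> : 1 - w - (1 - v) = - (w - v) by ring.
by rewrite normrN.
Qed.

Lemma diag_eval_cvg a w : disc1 w ->
  diag_eval a @ within disc1 (nbhs w) --> diag_eval a w.
Proof.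
move=> w1; have [_ ca] := (set_mem (Asym_funP a)).1.
have /subspace_continuousP := (subspace_valL_continuousP' _ (0 : C) _).2 ca.
move=> /(_ _ (cpolydisc_diag w1)) cv.
apply: cvg_comp cv => B /= oB.
have nB : \forall v \near w, cpolydisc R d (const_mx (1 - v)) ->
    B (const_mx (1 - v)) by exact: (cvg_diag oB).
have nB' : \forall v \near w, disc1 v -> B (const_mx (1 - v)).
  by apply: filterS nB => v vB v1; apply: vB; exact: cpolydisc_diag.
exact: nB'.
Qed.

End SymmetricPolydisc.

(** * An intersection of principal ideals that is not finitely generated *)

Section NotCoherent.
Variables (R : realType) (d : nat).
Hypothesis d_gt0 : (0 < d)%N.
Local Notation C := R[i].
Implicit Types (w : C) (a b : Asym R d).

(** A sequence tending to 0 along the circle Re(1/w) = c, which for c >= 1/2 is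
contained in [disc1]. *)
Definition horocycle (c : R) (n : nat) : C := (c +i* n%:R)^-1.

Let normc_horocycle_gt0 (c : R) n : 0 < c -> 0 < normc (c +i* n%:R).
Proof.
by move=> c0; rewrite normc_gt0 eq_complex /= gt_eqF.
Qed.

Lemma disc1_horocycle c n : 2^-1 <= c -> disc1 (horocycle c n).
Proof.
move=> c2; have c0 : 0 < c by apply: lt_le_trans c2; rewrite invr_gt0.
have p0 := normc_horocycle_gt0 n c0.
change (normc (1 - horocycle c n) <= 1).
have -> : 1 - horocycle c n = ((c - 1) +i* n%:R) / (c +i* n%:R).
  rewrite /horocycle -[X in X - _](@divff _ (c +i* n%:R)) -?normc_gt0//.
  rewrite -[X in _ - X]mul1r -mulrBl; congr (_ / _).
  by apply/eqP; rewrite eq_complex /= subr0 !eqxx.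
rewrite normcM normcV ler_pdivrMr// mul1r /=.
rewrite ler_wsqrtr// lerD2r; nra.
Qed.

Lemma cvg_horocycle (c : R) : 2^-1 <= c ->
  horocycle c @ \oo --> within (@disc1 R) (nbhs 0).
Proof.
move=> c2; have c0 : 0 < c by apply: lt_le_trans c2; rewrite invr_gt0.
move=> B /nbhscP[e e0 eB].
have [N eN] : exists N : nat, e^-1 < N%:R.
  by exists (Num.truncn e^-1).+1; rewrite truncnS_gt.
exists N => // n /= Nn; apply: eB; last exact: disc1_horocycle.
rewrite sub0r normcN normcV -[e]invrK ltf_pV2 ?posrE ?invr_gt0//; last first.
  exact: normc_horocycle_gt0.
rewrite (lt_le_trans eN)//.
have := Im_le_normc (c +i* n%:R); rewrite /= ger0_norm//.
by apply: le_trans; rewrite ler_nat.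
Qed.

Lemma disc1_0 : disc1 (0 : C).
Proof. by change (normc (1 - 0 : C) <= 1); rewrite subr0 normc1. Qed.

Lemma disc1_real (t : R) : 0 <= t -> t <= 1 -> disc1 t%:C.
Proof.
move=> t0 t1; change (normc (1 - t%:C) <= 1).
have -> : 1 - t%:C = (1 - t)%:C :> C by rewrite rmorphB.
by rewrite normc_real ger0_norm ?subr_ge0// gerBl.
Qed.

Lemma ideal_gen1 (A : comPzRingType) (x y : A) :
  ideal_gen [:: x] y <-> exists c, y = c * x.
Proof.
split=> [[c ->]|[c ->]]; first by rewrite big_ord1; exists (c ord0).
by exists (fun=> c); rewrite big_ord1.
Qed.

Definition halfplane_algebra_id_inner_exp :=
  halfplane_algebra_inner_exp (@halfplane_algebra_id R) erefl.

Let f : Asym R d := lift d_gt0 (@halfplane_algebra_id R).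
Let g : Asym R d := lift d_gt0 halfplane_algebra_id_inner_exp.

Lemma inner_exp_neq0 w : inner_exp w != 0.
Proof. by rewrite -normc_gt0 normc_inner_exp expR_gt0. Qed.

(** On a horocycle, |a| = exp(-c) |b|. In the limit this holds at 0 for c = 1/2
and for c = 1, with the same a(0) and b(0), which forces b(0) = 0. *)
Lemma conductor_vanish a b : a * f = b * g -> diag_eval b 0 = 0.
Proof.
move=> abE.
have abS w : disc1 w -> w != 0 -> diag_eval a w = inner_exp w * diag_eval b w.
  move=> w1 wn; apply: (mulIf wn).
  have := congr1 (fun h => diag_eval h w) abE.
  rewrite !diag_evalM !diag_eval_lift// => ->.
  by rewrite mulrCA mulrA.
have lim (c : R) : 2^-1 <= c ->
    normc (diag_eval a 0) = expR (- c) * normc (diag_eval b 0).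
  move=> c2; have c0 : 0 < c by apply: lt_le_trans c2; rewrite invr_gt0.
  have ch := cvg_horocycle c2.
  have cvg0 (h : Asym R d) : (fun n => normc (diag_eval h (horocycle c n))) @ \oo -->
      normc (diag_eval h 0).
    apply: (@cvg_normc _ _ _ _ (diag_eval h \o horocycle c)).
    by apply: cvg_comp ch _; exact: diag_eval_cvg disc1_0.
  have ca := cvg0 a; have cb := cvg0 b.
  have cb' : (fun n => expR (- c) * normc (diag_eval b (horocycle c n))) @ \oo
      --> expR (- c) * normc (diag_eval b 0) by exact: cvgMl_tmp cb.
  have eqab : (fun n => normc (diag_eval a (horocycle c n))) =
     (fun n => expR (- c) * normc (diag_eval b (horocycle c n))).
    apply/funext => n; rewrite abS; first last.
    - by rewrite invr_eq0 -normc_gt0 normc_horocycle_gt0.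
    - exact: disc1_horocycle.
    - by rewrite normcM normc_inner_exp /horocycle invrK.
  rewrite -[LHS](cvg_lim _ ca); last by [].
  rewrite -[RHS](cvg_lim _ cb'); last by [].
  by congr (limn _).
have l1 : normc (diag_eval a 0) = expR (- 2^-1) * normc (diag_eval b 0).
  by apply: lim.
have l2 : normc (diag_eval a 0) = expR (- 1) * normc (diag_eval b 0).
  by apply: lim; rewrite invf_le1// ler1n.
apply: eq0_normc; apply/eqP; apply: contraT => nb.
have /(mulIf nb)/expR_inj : expR (- 2^-1) * normc (diag_eval b 0) =
   expR (-1 : R) * normc (diag_eval b 0) by rewrite -l1.
lra.
Qed.

Lemma cvg_sum_ord (n : nat) (u : 'I_n -> nat -> R) (l : 'I_n -> R) :
  (forall i, u i @ \oo --> l i) ->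
  (fun k => \sum_(i < n) u i k) @ \oo --> \sum_(i < n) l i.
Proof.
move=> ul; apply: cvg_big => //; exact: add_continuous.
Qed.

Lemma slowly_vanishing_points (n : nat) (b : 'I_n -> Asym R d) :
  (forall i, diag_eval (b i) 0 = 0) ->
  exists eps : nat -> R, forall m,
    [/\ 0 < eps m, eps m <= 2^-1 ^+ m &
        forall i, normc (diag_eval (b i) (eps m)%:C) <= 8^-1 ^+ m].
Proof.
move=> b0.
suff : forall m, exists e : R, [/\ 0 < e, e <= 2^-1 ^+ m &
        forall i, normc (diag_eval (b i) e%:C) <= 8^-1 ^+ m].
  by move=> /choice[eps epsP]; exists eps.
move=> m.
have m8 : 0 < (8^-1 : R) ^+ m by rewrite exprn_gt0// invr_gt0.
have near_b : \forall w \near within (@disc1 R) (nbhs 0),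
    forall i, normc (diag_eval (b i) w) < 8^-1 ^+ m.
  apply: filter_forall => i.
  have /cvgcP/(_ _ m8) := diag_eval_cvg (a := b i) disc1_0.
  by apply: filterS => w; rewrite b0 sub0r normcN.
have /nbhscP[r r0 rb] := near_b.
pose e := Num.min (r / 2) (2^-1 ^+ m).
have e0 : 0 < e by rewrite lt_min divr_gt0// exprn_gt0// invr_gt0.
have e1 : e <= 2^-1 ^+ m by rewrite ge_min lexx orbT.
exists e; split=> // i; apply/ltW/rb.
  rewrite sub0r normcN normc_real gtr0_norm//.
  have : e <= r / 2 by rewrite ge_min lexx.
  move: r0; move: (e) => t; lra.
apply: disc1_real; first exact: ltW.
by rewrite (le_trans e1)// exprn_ile1 ?invr_ge0// invf_le1// ler1n.
Qed.

(** The generators are multiples b_i g with b_i vanishing at 0; the function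
[slow eps], built for points eps n at which all the b_i are tiny, vanishes at 0
too slowly to be a combination of the b_i. *)
Lemma conductor_not_fg : ~ fg_ideal (ideal_gen [:: f] `&` ideal_gen [:: g]).
Proof.
move=> [s sE].
have /choice[b bg] (i : 'I_(size s)) :
    exists b, s`_i = b * g /\ diag_eval b 0 = 0.
  have : ideal_gen s s`_i.
    exists (fun j => (j == i)%:R).
    rewrite (bigD1 i)//= eqxx mul1r big1 ?addr0// => j /negPf ->.
    by rewrite mul0r.
  rewrite -sE => -[/ideal_gen1[a ea] /ideal_gen1[b eb]].
  by exists b; split=> //; apply: (@conductor_vanish a); rewrite -ea.
have [eps epsP] := @slowly_vanishing_points _ b (fun i => (bg i).2).
have eps0 m : 0 < eps m by have [] := epsP m.
have hk := halfplane_algebra_slow eps0.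
have hl := halfplane_algebra_inner_exp hk (slow0 eps).
have : ideal_gen s (lift d_gt0 hk * g).
  rewrite -sE; split; apply/ideal_gen1; last by exists (lift d_gt0 hk).
  exists (lift d_gt0 hl); apply: val_inj; apply/funext => x.
  change (slow eps (offset (val x)) *
    (inner_exp (offset (val x)) * offset (val x)) =
     inner_exp (offset (val x)) * slow eps (offset (val x)) * offset (val x)).
  by rewrite mulrCA mulrA.
case=> c kg.
have eps1 m : disc1 (eps m)%:C.
  have [e0 e1 _] := epsP m; apply: disc1_real; first exact: ltW.
  by rewrite (le_trans e1)// exprn_ile1 ?invr_ge0// invf_le1// ler1n.
have eps_cvg : (fun m => (eps m)%:C) @ \oo --> within (@disc1 R) (nbhs 0).
  move=> B /nbhscP[r r0 rB].
  have /cvgrPdist_lt/(_ _ r0) := @cvg_half R; apply: filterS => m /= mr.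
  apply: rB (eps1 m).
  have [e0 e1 _] := epsP m; rewrite sub0r normcN normc_real gtr0_norm//.
  by rewrite (le_lt_trans e1)//; move: mr; rewrite sub0r normrN ger0_norm//.
have slowE m : slow eps (eps m)%:C =
    \sum_i diag_eval (c i) (eps m)%:C * diag_eval (b i) (eps m)%:C.
  have e0 : (eps m)%:C != 0 :> C by rewrite -normc_gt0 normc_real gtr0_norm.
  apply: (@mulIf _ (inner_exp (eps m)%:C * (eps m)%:C)).
    by rewrite mulf_neq0// inner_exp_neq0.
  have := congr1 (fun h => diag_eval h (eps m)%:C) kg.
  rewrite /= diag_evalM diag_eval_sum !diag_eval_lift// => ->.
  rewrite mulr_suml; apply: eq_bigr => i _.
  by rewrite (bg i).1 !diag_evalM diag_eval_lift// mulrA.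
(* 8^-n from the b_i against 4^-n / 2 from slow_ge leaves a factor 2^n *)
have growth m : 2^-1 <= 2^-1 ^+ m * \sum_i normc (diag_eval (c i) (eps m)%:C).
  have m4 : 0 < (4^-1 : R) ^+ m by rewrite exprn_gt0// invr_gt0.
  rewrite -(ler_pM2l m4) mulrA -exprMn.
  have -> : (4^-1 : R) * 2^-1 = 8^-1 by field.
  rewrite (le_trans (slow_ge eps0 m))// slowE (le_trans (normc_sum _ _ _))//.
  rewrite mulr_sumr; apply: ler_sum => i _.
  have [_ _ bm] := epsP m.
  by rewrite normcM mulrC ler_wpM2r ?normc_ge0.
have coef_cvg : (fun m => \sum_i normc (diag_eval (c i) (eps m)%:C)) @ \oo -->
    \sum_i normc (diag_eval (c i) 0).
  apply: cvg_sum_ord => i.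
  apply: (@cvg_normc _ _ _ _ (diag_eval (c i) \o fun m => (eps m)%:C)).
  by apply: cvg_comp eps_cvg _; exact: diag_eval_cvg disc1_0.
have prod_cvg : (fun m => 2^-1 ^+ m *
    \sum_i normc (diag_eval (c i) (eps m)%:C)) @ \oo -->
    0 * \sum_i normc (diag_eval (c i) 0) by exact: cvgM (@cvg_half R) coef_cvg.
have : (2^-1 : R) <= 0 * \sum_i normc (diag_eval (c i) 0).
  rewrite -[leRHS](cvg_lim _ prod_cvg); last by [].
  apply: limr_ge; first by apply/cvg_ex; eexists; exact: prod_cvg.
  by apply: nearW => m; exact: growth.
by rewrite mul0r invr_le0 lern0.
Qed.

End NotCoherent.

Theorem corollary6p4 (R : realType) (d : nat) (d_gt0 : (0 < d)%N) :
  ~ coherent (Asym R d).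
Proof.
move=> [fgI _]; apply: (@conductor_not_fg R d d_gt0); apply: fgI.
- by exists [:: lift d_gt0 (@halfplane_algebra_id R)].
- by exists [:: lift d_gt0 (@halfplane_algebra_id_inner_exp R)].
Qed.
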